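(* Let $N$ be a complete Riemannian manifold with positive sectional curvature. Let $M_1$ and $M_2$ be two minimal hypersurfaces immersed in $N\times\mathbb{R}$, where $M_1$ is closed and $M_2$ is proper. Then, up to a vertical translation, they intersect, i.e. $p_1(M_1)\cap p_1(M_2)\neq\emptyset$.
   Context: Manifolds are connected and nonempty, as usual. $N\times\mathbb{R}$ carries the product metric, and $p_1:N\times\mathbb{R}\to N$ is the projection on the first factor. Closed means compact without boundary; $M_2$ proper means that it is properly immersed; minimal means that the mean curvature vanishes identically. A vertical translation is a map $(x,t)\mapsto(x,t+s)$ of $N\times\mathbb{R}$ for a fixed $s\in\mathbb{R}$. *)

(* Defs.v *)
From HB Require Import structures.
From mathcomp Require Import all_boot all_order all_algebra.
From mathcomp Require Import all_classical all_reals all_analysis.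

Set Implicit Arguments.
Unset Strict Implicit.
Unset Printing Implicit Defensive.

Import Order.TTheory GRing.Theory Num.Theory.
Import numFieldNormedType.Exports.

Local Open Scope classical_set_scope.
Local Open Scope ring_scope.

(* Tangent vectors are row vectors acting on the left of matrices, as in
   ['D_v f x = v *m jacobian f x] ([deriveEjacobian]): row [a] of the Jacobian
   matrix of [f] is the partial derivative of [f] along the [a]-th
   coordinate. *)

Section Coordinates.
Context {R : realType}.

(* [Ck k U f] is meant for open [U]. In finite dimension, [f] is C^(k+1) on [U]
   iff it is differentiable at each point of [U] with all its directional
   derivatives of class C^k on [U]. *)
Fixpoint Ck (k : nat) (m : nat) (W : normedModType R)
    (U : set 'rV[R]_m) (f : 'rV[R]_m -> W) : Prop :=
  match k with
  | 0 => forall x, U x -> {for x, continuous f}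
  | k'.+1 => (forall x, U x -> differentiable f x) /\
             (forall v, Ck k' U (fun x => 'D_v f x))
  end.

Definition smooth_on m (W : normedModType R)
    (U : set 'rV[R]_m) (f : 'rV[R]_m -> W) : Prop :=
  forall k, Ck k U f.

Definition partial m (W : normedModType R) (a : 'I_m)
    (f : 'rV[R]_m -> W) (x : 'rV[R]_m) : W :=
  'D_(delta_mx 0 a : 'rV[R]_m) f x.

Definition inner m (G : 'M[R]_m) (u v : 'rV[R]_m) : R :=
  (u *m G *m v^T) 0 0.

(* In what follows [g : 'rV[R]_m -> 'M[R]_m] is the Gram matrix of a metric in
   some coordinates. *)

(* The Christoffel symbol Gamma_ij^k of the Levi-Civita connection. *)
Definition christoffel m (g : 'rV[R]_m -> 'M[R]_m) (i j k : 'I_m)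
    (x : 'rV[R]_m) : R :=
  2^-1 * \sum_(l < m) invmx (g x) k l *
    (partial i (fun y => g y j l) x + partial j (fun y => g y i l) x
     - partial l (fun y => g y i j) x).

(* R(d_i, d_j) d_k = sum_l (riemann g i j k l) d_l, with the sign convention
   R(X, Y) Z = D_X D_Y Z - D_Y D_X Z - D_[X, Y] Z. *)
Definition riemann m (g : 'rV[R]_m -> 'M[R]_m) (i j k l : 'I_m)
    (x : 'rV[R]_m) : R :=
  partial i (christoffel g j k l) x - partial j (christoffel g i k l) x
  + \sum_(p < m) (christoffel g j k p x * christoffel g i p l x
                  - christoffel g i k p x * christoffel g j p l x).

Definition curvature m (g : 'rV[R]_m -> 'M[R]_m) (x u v w : 'rV[R]_m) :
    'rV[R]_m :=
  \row_l \sum_(i < m) \sum_(j < m) \sum_(k < m)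
    u 0 i * v 0 j * w 0 k * riemann g i j k l x.

Definition sectional_curvature m (g : 'rV[R]_m -> 'M[R]_m)
    (x u v : 'rV[R]_m) : R :=
  inner (g x) (curvature g x u v v) u /
  (inner (g x) u u * inner (g x) v v - inner (g x) u v ^+ 2).

(* An immersion [f] between coordinate domains, the target being endowed with
   the metric [G]. *)
Section Immersion.
Variables (m p : nat) (G : 'rV[R]_p -> 'M[R]_p) (f : 'rV[R]_m -> 'rV[R]_p).

Definition first_form (x : 'rV[R]_m) : 'M[R]_m :=
  jacobian f x *m G (f x) *m (jacobian f x)^T.

(* The ambient covariant derivative of d_b f along d_a f. *)
Definition cov_deriv (a b : 'I_m) (x : 'rV[R]_m) : 'rV[R]_p :=
  partial a (partial b f) x +
  \row_k \sum_(i < p) \sum_(j < p)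
    partial a f x 0 i * partial b f x 0 j * christoffel G i j k (f x).

(* Orthogonal projection onto the normal space of [f] at [x]. *)
Definition normal_part (x : 'rV[R]_m) (v : 'rV[R]_p) : 'rV[R]_p :=
  v - v *m G (f x) *m (jacobian f x)^T *m invmx (first_form x)
        *m jacobian f x.

Definition second_form (a b : 'I_m) (x : 'rV[R]_m) : 'rV[R]_p :=
  normal_part x (cov_deriv a b x).

(* The mean curvature vector, as the trace of the second fundamental form (not
   divided by the dimension [m]). *)
Definition mean_curvature (x : 'rV[R]_m) : 'rV[R]_p :=
  \sum_(a < m) \sum_(b < m) invmx (first_form x) a b *: second_form a b x.

End Immersion.
End Coordinates.

(* The underlying data of an [n]-dimensional atlas on [T]: the [i]-th chart maps
   [dom i] onto [cod i] by [crd i], with inverse [par i]; the values of [crd i]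
   outside [dom i] and of [par i] outside [cod i] are irrelevant. *)
Record atlas (R : realType) (n : nat) (T : topologicalType) := Atlas {
  idx : Type;
  dom : idx -> set T;
  cod : idx -> set 'rV[R]_n;
  crd : idx -> T -> 'rV[R]_n;
  par : idx -> 'rV[R]_n -> T }.

Section Manifolds.
Context {R : realType}.

(* The domain of [local_expr A B F i j] below. *)
Definition local_dom m n (S T : topologicalType) (A : atlas R m S)
    (B : atlas R n T) (F : S -> T) (i : idx A) (j : idx B) : set 'rV[R]_m :=
  [set x | cod i x /\ dom j (F (par i x))].

Definition local_expr m n (S T : topologicalType) (A : atlas R m S)
    (B : atlas R n T) (F : S -> T) (i : idx A) (j : idx B) :
    'rV[R]_m -> 'rV[R]_n :=
  fun x => crd j (F (par i x)).

Definition is_chart n (T : topologicalType) (A : atlas R n T) (i : idx A) :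
    Prop :=
  [/\ open (dom i), open (cod i),
      (forall p, dom i p ->
         [/\ cod i (crd i p), par i (crd i p) = p &
             {for p, continuous (crd i)}]) &
      (forall x, cod i x ->
         [/\ dom i (par i x), crd i (par i x) = x &
             {for x, continuous (par i)}])].

(* Smooth connected nonempty manifolds without boundary. The atlas is not
   required to be maximal. *)
Definition is_manifold n (T : topologicalType) (A : atlas R n T) : Prop :=
  [/\ hausdorff_space T, @second_countable T, connected [set: T] &
      [set: T] !=set0] /\
  [/\ (forall i : idx A, is_chart i),
      (forall p : T, exists i : idx A, dom i p) &
      (forall i j : idx A, smooth_on (local_dom id i j) (local_expr id i j))].

Definition smooth_map m n (S T : topologicalType) (A : atlas R m S)
    (B : atlas R n T) (F : S -> T) : Prop :=
  continuous F /\
  (forall (i : idx A) (j : idx B),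
     smooth_on (local_dom F i j) (local_expr F i j)).

Definition immersion m n (S T : topologicalType) (A : atlas R m S)
    (B : atlas R n T) (F : S -> T) : Prop :=
  smooth_map A B F /\
  (forall (i : idx A) (j : idx B) x, local_dom F i j x ->
     injective ('d (local_expr F i j) x)).

Definition proper_map (S T : topologicalType) (F : S -> T) : Prop :=
  forall K : set T, compact K -> compact (F @^-1` K).

(* A metric is given by its Gram matrix in each chart. *)
Definition metric_data n (T : topologicalType) (A : atlas R n T) : Type :=
  idx A -> 'rV[R]_n -> 'M[R]_n.

Definition is_riemannian n (T : topologicalType) (A : atlas R n T)
    (g : metric_data A) : Prop :=
  [/\ (forall i, smooth_on (cod i) (g i)),
      (forall i x, cod i x -> (g i x)^T = g i x),
      (forall i x v, cod i x -> v != 0 -> 0 < inner (g i x) v v) &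
      (forall i j x, local_dom id i j x ->
         g i x = first_form (g j) (local_expr id i j) x)].

(* Geodesics defined on the whole real line. *)
Definition geodesic n (T : topologicalType) (A : atlas R n T)
    (g : metric_data A) (gamma : R -> T) : Prop :=
  continuous gamma /\
  forall (i : idx A) (t : R), dom i (gamma t) ->
    let c : R -> 'rV[R]_n := fun s => crd i (gamma s) in
    [/\ derivable c t 1, derivable (derive1 c) t 1 &
        forall k, derive1 (derive1 c) t 0 k +
          \sum_(a < n) \sum_(b < n)
            christoffel (g i) a b k (c t) * derive1 c t 0 a * derive1 c t 0 b
          = 0].

(* Geodesic completeness: a geodesic defined for all times starts from each
   tangent vector. *)
Definition complete_metric n (T : topologicalType) (A : atlas R n T)
    (g : metric_data A) : Prop :=
  forall (i : idx A) (x v : 'rV[R]_n), cod i x ->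
    exists gamma : R -> T,
      [/\ geodesic g gamma, gamma 0 = par i x &
          derive1 (fun s => crd i (gamma s)) 0 = v].

(* The tangent 2-planes at a point are given by their bases [u], [v]. *)
Definition positive_sectional_curvature n (T : topologicalType)
    (A : atlas R n T) (g : metric_data A) : Prop :=
  forall (i : idx A) (x u v : 'rV[R]_n), cod i x -> row_free (col_mx u v) ->
    0 < sectional_curvature (g i) x u v.

Definition minimal m n (S T : topologicalType) (A : atlas R m S)
    (B : atlas R n T) (g : metric_data B) (F : S -> T) : Prop :=
  forall (i : idx A) (j : idx B) x, local_dom F i j x ->
    mean_curvature (g j) (local_expr F i j) x = 0.

(* The product [N * R] with the metric g + dt^2; the coordinate on [R] comes
   last. *)
Definition cyl_atlas n (N : topologicalType) (A : atlas R n N) :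
    atlas R (n + 1) (N * R)%type :=
  {| idx := idx A;
     dom := fun i => [set p | dom i p.1];
     cod := fun i => [set x | cod i (lsubmx x)];
     crd := fun i p => row_mx (crd i p.1) (const_mx p.2);
     par := fun i x => (par i (lsubmx x), rsubmx x 0 0) |}.

Definition cyl_metric n (N : topologicalType) (A : atlas R n N)
    (g : metric_data A) : metric_data (cyl_atlas A) :=
  fun (i : idx A) x => block_mx (g i (lsubmx x)) 0 0 1%:M.

Definition vtrans (N : Type) (s : R) (p : N * R) : N * R := (p.1, p.2 + s).

End Manifolds.

(* Main.v *)
(* The vertical field is parallel on [N * R], so the height of a minimal
   hypersurface satisfies a linear elliptic equation without zeroth-order term in
   each chart. On the closed connected [M1] the height attains its maximum and, by
   the strong maximum principle, is constant: [M1] lies in a horizontal slice and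
   [p_1 \o F1] is an immersion between manifolds of the same dimension. Its image
   is open and compact, hence equal to [N], and every point of [p_1(M2)] lies in
   it. *)

Require Import Defs.
From HB Require Import structures.
From mathcomp Require Import all_boot all_order all_algebra.
From mathcomp Require Import all_classical all_reals all_analysis.
From mathcomp Require Import ring lra.
Set Implicit Arguments.
Unset Strict Implicit.
Unset Printing Implicit Defensive.
Import Order.TTheory GRing.Theory Num.Theory.
Import numFieldNormedType.Exports.
Local Open Scope classical_set_scope.
Local Open Scope ring_scope.

(** * Positive definite matrices *)

Section LinearAlgebra.
Context {R : realType}.

(** The equation for the height is one component of the mean curvature vector: the Christoffel
    symbols with upper index in the [R]-direction vanish, and the normal projection subtracts only
    first-order terms. Its coefficients contain derivatives of the immersion itself, but they are
    treated as given continuous functions, so the maximum principle is proved for linear operators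
    with continuous coefficients and positive definite principal part. In Hopf's argument the usual
    exponential barrier is replaced by [A * s ^+ 2 - s], where [s] vanishes on the sphere with the
    segment from [y] to [z] as a diameter. That sphere touches the sphere about [y] through [z] from
    inside, at [z] alone. Along lines the barrier is a polynomial, so its derivatives are computed
    formally. Openness of the projection comes from minimising the squared distance to a target
    point, not from constructing a local inverse. *)

Lemma innerDl n (A B : 'M[R]_n) (u v : 'rV[R]_n) :
  inner (A + B) u v = inner A u v + inner B u v.
Proof. by rewrite /inner mulmxDr mulmxDl mxE. Qed.

Lemma innerZl n (c : R) (A : 'M[R]_n) (u v : 'rV[R]_n) :
  inner (c *: A) u v = c * inner A u v.
Proof. by rewrite /inner -scalemxAr -scalemxAl mxE. Qed.

Lemma inner_rank1 n (w u v : 'rV[R]_n) :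
  inner (w^T *m w) u v = (u *m w^T) 0 0 * (v *m w^T) 0 0.
Proof.
rewrite /inner mulmxA -mulmxA mxE big_ord1; congr (_ * _).
by rewrite -(trmxK w) -trmx_mul mxE trmxK.
Qed.

Lemma inner1 n (v : 'rV[R]_n) : inner 1%:M v v = \sum_k v 0 k ^+ 2.
Proof.
by rewrite /inner mulmx1 mxE; apply: eq_bigr => k _; rewrite mxE expr2.
Qed.

Lemma inner_block n (C : 'M[R]_n) (x : 'rV[R]_(1 + n)) :
  inner (block_mx 0 0 0 C) x x = inner C (rsubmx x) (rsubmx x).
Proof.
rewrite /inner -{1 2}(hsubmxK x) mul_row_block !mulmx0 !addr0 add0r tr_row_mx.
by rewrite mul_row_col mul0mx add0r.
Qed.

(* One step of the LDL decomposition, which is how the positive definite matrix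
   is reduced to rank-one matrices below. *)
Lemma schur_complement n (A : 'M[R]_(1 + n)) : A^T = A ->
  (forall v : 'rV[R]_(1 + n), v != 0 -> 0 < inner A v v) ->
  exists (c : R) (w : 'rV[R]_(1 + n)) (C : 'M[R]_n),
    [/\ 0 < c, C^T = C, (forall v : 'rV[R]_n, v != 0 -> 0 < inner C v v) &
        A = c *: (w^T *m w) + block_mx 0 0 0 C].
Proof.
move=> As Ap; set al := A 0 0; set b := ursubmx A.
have al0 : 0 < al.
  have := Ap (delta_mx 0 0); rewrite /inner -rowE trmx_delta -colE !mxE; apply.
  by apply/eqP => /matrixP/(_ 0 0)/eqP; rewrite !mxE !eqxx oner_eq0.
have ulE : ulsubmx A = al%:M.
  by apply/matrixP => i j; rewrite !ord1 !mxE eqxx mulr1n; congr (A _ _);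
    apply: val_inj.
have dlE : dlsubmx A = b^T by rewrite /b trmx_ursub As.
pose w : 'rV[R]_(1 + n) := row_mx al%:M b.
pose C := drsubmx A - al^-1 *: (b^T *m b).
have AE : A = al^-1 *: (w^T *m w) + block_mx 0 0 0 C.
  rewrite -{1}(submxK A) ulE dlE -/b /w tr_row_mx tr_scalar_mx mul_col_row.
  rewrite scale_block_mx add_block_mx !addr0 /C addrC -scalar_mxM.
  rewrite mul_scalar_mx mul_mx_scalar !scalerA mulVf ?gt_eqF// !scale1r.
  rewrite -scale_scalar_mx scalerA mulVf ?gt_eqF// scale1r.
  by rewrite subrK.
exists al^-1, w, C; split => //; first by rewrite invr_gt0.
- by rewrite /C linearB/= linearZ/= trmx_mul trmxK trmx_drsub As.
(* The first entry of [x] makes it orthogonal to [w], so the rank-one term vanishes there and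
   [inner A x x] reduces to [inner C v v]. *)
- move=> v v0; pose x : 'rV[R]_(1 + n) := row_mx (- al^-1 *: (v *m b^T)) v.
  have x0 : x != 0.
    by apply: contraNneq v0 => /(congr1 rsubmx); rewrite row_mxKr linear0 => ->.
  have := Ap _ x0; rewrite AE innerDl innerZl inner_rank1 inner_block row_mxKr.
  suff -> : x *m w^T = 0 by rewrite mxE mulr0 mulr0 add0r.
  rewrite /x /w tr_row_mx mul_row_col tr_scalar_mx mul_mx_scalar scalerA.
  by rewrite mulrN mulfV ?gt_eqF// scaleN1r addNr.
Qed.

(** In the splitting of [schur_complement] the rank-one term contributes [c * inner H w w]; the
    other term pairs [C] with the lower right block of [H], the restriction of the form to vectors
    with zero first entry, and falls under the induction hypothesis. *)
Lemma trace_posdef_le0 n (A H : 'M[R]_n) : A^T = A ->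
  (forall v : 'rV[R]_n, v != 0 -> 0 < inner A v v) ->
  (forall v, inner H v v <= 0) -> \tr (A *m H) <= 0.
Proof.
elim: n A H => [|n IH]; first by move=> *; rewrite /mxtrace big_ord0.
rewrite -[n.+1]/(1 + n)%N => A H As Ap Hn.
have [c [w [C [c0 Cs Cp AE]]]] := @schur_complement n A As Ap.
rewrite {}AE mulmxDl -scalemxAl mxtraceD mxtraceZ -mulmxA mxtrace_mulC.
rewrite -[leRHS]addr0; apply: lerD.
  rewrite mulr_ge0_le0 ?(ltW c0)//.
  by have := Hn w; rewrite /inner trace_mx11.
rewrite -{1}(submxK (H : 'M[R]_(1 + n))) mulmx_block !mul0mx !addr0 !add0r.
rewrite mxtrace_block mxtrace0 add0r.
apply: IH => // v; have := Hn (row_mx 0 v : 'rV_(1 + n)).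
rewrite /inner -{1}(submxK (H : 'M[R]_(1 + n))) mul_row_block !mul0mx !add0r.
by rewrite tr_row_mx mul_row_col trmx0 mulmx0 add0r.
Qed.

Lemma posdef_unitmx n (A : 'M[R]_n) :
  (forall v : 'rV[R]_n, v != 0 -> 0 < inner A v v) -> A \in unitmx.
Proof.
move=> Ap; rewrite -row_free_unit -kermx_eq0; apply/rowV0P => v /sub_kermxP vA.
by apply/eqP/negPn/negP => /Ap; rewrite /inner vA mul0mx mxE ltxx.
Qed.

Lemma posdef_invmx n (A : 'M[R]_n) : A^T = A ->
  (forall v : 'rV[R]_n, v != 0 -> 0 < inner A v v) ->
  forall v : 'rV[R]_n, v != 0 -> 0 < inner (invmx A) v v.
Proof.
move=> As Ap v v0; have Au := posdef_unitmx Ap.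
have vE : v = v *m invmx A *m A by rewrite mulmxKV.
have /Ap : v *m invmx A != 0.
  by apply: contraNneq v0 => v'0; rewrite vE v'0 mul0mx.
by rewrite /inner mulmxKV// trmx_mul trmx_inv As mulmxA.
Qed.

Lemma posdef_congr m p (J : 'M[R]_(m, p)) (G : 'M[R]_p) :
  (forall v : 'rV[R]_p, v != 0 -> 0 < inner G v v) ->
  (forall v : 'rV_m, v *m J = 0 -> v = 0) ->
  forall v : 'rV[R]_m, v != 0 -> 0 < inner (J *m G *m J^T) v v.
Proof.
move=> Gp Jinj v v0.
have /Gp : v *m J != 0 by apply: contraNneq v0 => /Jinj ->.
by rewrite /inner trmx_mul !mulmxA.
Qed.

End LinearAlgebra.

(** * Derivatives and limits *)

Section Calculus.
Context {R : realType}.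

Lemma mx_cvg (T : Type) (F : set_system T) {FF : Filter F} m n
    (f : T -> 'M[R]_(m, n)) (M : 'M[R]_(m, n)) :
  (forall i j, f x i j @[x --> F] --> M i j) -> f @ F --> M.
Proof.
move=> fM; apply/cvgrPdist_le => e e0; near=> x.
rewrite [leLHS]/Num.Def.normr/= mx_normrE (bigmax_le _ (ltW e0))//= => -[i j] _.
rewrite !mxE/=; move: i j; near: x.
by apply: filter_forall => i; apply: filter_forall => j; exact: cvgr_dist_le.
Unshelve. all: by end_near. Qed.

Lemma is_derive_line (V W : normedModType R) (f : V -> W) (x v : V) (t : R) w :
  is_derive (t *: v + x) v f w ->
  is_derive t 1 (fun s => f (s *: v + x)) w.
Proof.
have E : (fun h => h^-1 *: (f ((h *: 1%R + t) *: v + x) - f (t *: v + x))) =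
         (fun h : R => h^-1 *: (f (h *: v + (t *: v + x)) - f (t *: v + x))).
  by apply/funext => h; rewrite [_ *: 1%R]mulr1 scalerDl addrA.
case=> df dfE; apply: DeriveDef; first by rewrite /derivable/= E.
by rewrite /derive/= E.
Qed.

Lemma derive_sum_partial m (W : normedModType R) (f : 'rV[R]_m -> W)
    (x v : 'rV[R]_m) : differentiable f x ->
  'D_v f x = \sum_a v 0 a *: partial a f x.
Proof.
move=> df; rewrite deriveE// {1}(row_sum_delta v) linear_sum.
by apply: eq_bigr => a _; rewrite linearZ /partial deriveE.
Qed.

Definition hessian m (u : 'rV[R]_m -> R) (x : 'rV[R]_m) : 'M[R]_m :=
  \matrix_(a, b) partial a (partial b u) x.

Lemma derive2_hessian m (u : 'rV[R]_m -> R) (U : set 'rV[R]_m) (x v : 'rV[R]_m) :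
  open U -> U x -> (forall y, U y -> differentiable u y) ->
  (forall w y, U y -> differentiable ('D_w u) y) ->
  'D_v ('D_v u) x = inner (hessian u x) v v.
Proof.
move=> oU Ux du ddu; rewrite derive_sum_partial; last exact: ddu.
rewrite /inner mxE.
under [RHS]eq_bigr => j _ do rewrite !mxE mulr_suml.
rewrite exchange_big/=; apply: eq_bigr => a _.
rewrite /partial (@near_eq_derive _ _ _ _ (\sum_b v 0 b *: partial b u)).
  rewrite derive_sum; last by move=> b; apply/derivableZ/diff_derivable/ddu.
  rewrite scaler_sumr; apply: eq_bigr => b _.
  rewrite deriveZ; last exact/diff_derivable/ddu.
  by rewrite mxE -/(partial b u) /partial /GRing.scale/= mulrCA mulrC.
near=> y; rewrite derive_sum_partial; last first.
  by apply: du; near: y; exact: open_nbhs_nbhs.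
by rewrite fct_sumE.
Unshelve. all: by end_near. Qed.

(** If [f2] were positive, [f1] would be positive just to the right of its zero, and [f] would
    increase strictly there, against maximality. *)
Lemma derivative_test_max (f f1 : R -> R) (f2 : R) :
  (\forall t \near (0 : R), is_derive (t : R) (1 : R) f (f1 t)) -> is_derive (0 : R) (1 : R) f1 f2 ->
  (\forall t \near (0 : R), f t <= f 0) -> f1 0 = 0 /\ f2 <= 0.
Proof.
move=> df df1 fmax.
have [e e0 He] : exists2 e : R, 0 < e &
    forall t : R, `|t| < e -> is_derive t (1 : R) f (f1 t) /\ f t <= f 0.
  have [e e0 He] := (nbhs_ballP _ _).1 (filterI df fmax).
  by exists e => // t te; apply: He; rewrite /ball/= sub0r normrN.
have f10 : f1 0 = 0.
  have [] := He 0; first by rewrite normr0.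
  move=> d0 _; have := @derive1_at_max R f (- e / 2) (e / 2) 0.
  case=> //.
  - by lra.
  - move=> t; rewrite in_itv/= => tee; have [] := He t.
      by rewrite ltr_norml; lra.
    by move=> [].
  - by rewrite in_itv/=; lra.
  - move=> t; rewrite in_itv/= => tee; have [] := He t => //.
    by rewrite ltr_norml; lra.
  - by move=> _; rewrite derive_val.
split => //; rewrite leNgt; apply/negP => f2_gt0.
have : \forall t \near (0 : R)^', 0 < t^-1 * (f1 t).
  have [/cvg_ex[l fl] dE] := df1.
  have lE : l = f2 by rewrite -dE; apply/esym/cvg_lim.
  rewrite lE in fl; have fl' := cvgr_gt _ fl _ f2_gt0; near=> t.
  have : 0 < t^-1 *: ((f1 \o shift 0) t%:A - f1 0). by near: t; exact: fl'.
  by rewrite /= f10 subr0 addr0 [t *: 1]mulr1.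
case/nbhs_ballP => d /= d0 Hd.
pose c := Num.min d e / 2.
have c0 : 0 < c by rewrite divr_gt0// lt_min d0.
have cd : c < d by rewrite ltr_pdivrMr// gt_min; apply/orP; left; lra.
have ce : c < e by rewrite ltr_pdivrMr// gt_min; apply/orP; right; lra.
have [_ ] : is_derive c (1 : R) f (f1 c) /\ f c <= f 0.
  by apply: He; rewrite gtr0_norm.
rewrite leNgt => /negP; apply.
apply: (@gtr0_derive1_incr R f 0 c) => //.
- move=> t; rewrite in_itv/= => tc; have [] := He t.
    by rewrite ltr_norml; lra.
  by move=> [].
- move=> t; rewrite in_itv/= => tc; have [] := He t.
    by rewrite ltr_norml; lra.
  move=> dt _; rewrite derive1E derive_val.
  have := Hd t; rewrite /ball/= sub0r normrN pmulr_rgt0; last by rewrite invr_gt0; lra.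
  by apply; [rewrite ltr_norml; lra|rewrite gt_eqF//; lra].
- apply: derivable_within_continuous => t; rewrite in_itv/= => tc.
  have /He[[]] : `|t| < e by rewrite ltr_norml; lra.
  by [].
Unshelve. all: by end_near. Qed.

End Calculus.

(** * Limits of matrix expressions *)

Section MatrixLimits.
Context {R : realType} {T : Type} (F : set_system T) {FF : Filter F}.

Lemma sum_cvg (W : normedModType R) (I : Type) (r : seq I) (P : pred I)
    (f : I -> T -> W) (l : I -> W) :
  (forall i, P i -> f i x @[x --> F] --> l i) ->
  \sum_(i <- r | P i) f i x @[x --> F] --> \sum_(i <- r | P i) l i.
Proof. by apply: cvg_big => // x; exact: add_continuous. Qed.

Lemma prod_cvg (I : Type) (r : seq I) (P : pred I) (f : I -> T -> R) (l : I -> R) :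
  (forall i, P i -> f i x @[x --> F] --> l i) ->
  \prod_(i <- r | P i) f i x @[x --> F] --> \prod_(i <- r | P i) l i.
Proof. by apply: cvg_big => // x; exact: mul_continuous. Qed.

Lemma coord_cvg m n (f : T -> 'M[R]_(m, n)) (M : 'M[R]_(m, n)) i j :
  f @ F --> M -> f x i j @[x --> F] --> M i j.
Proof. by move=> fM; exact: (cvg_comp _ _ fM (@coord_continuous _ _ _ i j M)). Qed.

Lemma mulmx_cvg m n p (f : T -> 'M[R]_(m, n)) (g : T -> 'M[R]_(n, p))
    (A : 'M[R]_(m, n)) (B : 'M[R]_(n, p)) :
  f @ F --> A -> g @ F --> B -> f x *m g x @[x --> F] --> A *m B.
Proof.
move=> fA gB; apply: mx_cvg => i j; rewrite mxE.
under eq_cvg do rewrite mxE.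
by apply: sum_cvg => k _; apply: cvgM; exact: coord_cvg.
Qed.

Lemma trmx_cvg m n (f : T -> 'M[R]_(m, n)) (A : 'M[R]_(m, n)) :
  f @ F --> A -> (f x)^T @[x --> F] --> A^T.
Proof.
move=> fA; apply: mx_cvg => i j; rewrite mxE.
by under eq_cvg do rewrite mxE; exact: coord_cvg.
Qed.

Lemma det_cvg n (f : T -> 'M[R]_n) (A : 'M[R]_n) :
  f @ F --> A -> \det (f x) @[x --> F] --> \det A.
Proof.
move=> fA; apply: sum_cvg => s _; apply: cvgM; first exact: cvg_cst.
by apply: prod_cvg => i _; exact: coord_cvg.
Qed.

(** Cramer's formula reduces the claim to determinants; [invmx] is given by it only at invertible
    matrices, which the values of [f] eventually are because the determinant converges to a nonzero
    limit. *)
Lemma invmx_cvg n (f : T -> 'M[R]_n) (A : 'M[R]_n) :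
  A \in unitmx ->
  f @ F --> A -> invmx (f x) @[x --> F] --> invmx A.
Proof.
move=> Au fA.
have dA : \det A != 0 by move: Au; rewrite unitmxE unitfE.
have fu : \forall x \near F, f x \in unitmx.
  near=> x; rewrite unitmxE unitfE; near: x.
  exact: (det_cvg fA (open_nbhs_nbhs (conj (@open_neq R 0) dA))).
apply: (@cvg_trans _ ((\det (f x))^-1 *: \adj (f x) @[x --> F])).
  by apply: near_eq_cvg; near=> x; rewrite /invmx ifT//; near: x.
rewrite /invmx Au; apply: cvgZ; first by apply: cvgV => //; exact: det_cvg.
apply: mx_cvg => i j; rewrite mxE; under eq_cvg do rewrite mxE.
apply: cvgM; first exact: cvg_cst.
apply: det_cvg; apply: mx_cvg => k l; rewrite !mxE.
by under eq_cvg do rewrite !mxE; exact: coord_cvg.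
Unshelve. all: by end_near. Qed.

End MatrixLimits.

(** * Euclidean distance, compact balls and lines *)

Section EuclideanBalls.
Context {R : realType}.

(** The norm of row vectors is the maximum of the entries, which is not differentiable; distances
    that are differentiated are therefore Euclidean, while neighbourhoods stay in the maximum
    norm. *)
Definition sqnorm n (v : 'rV[R]_n) : R := \sum_k v 0 k ^+ 2.

Lemma sqnorm_ge0 n (v : 'rV[R]_n) : 0 <= sqnorm v.
Proof. by apply: sumr_ge0 => k _; exact: sqr_ge0. Qed.

Lemma norm_sqr_le_sqnorm n (v : 'rV[R]_n) : `|v| ^+ 2 <= sqnorm v.
Proof.
have [->|v0] := eqVneq v 0; first by rewrite normr0 expr0n sqnorm_ge0.
have [|[i j] /= vE] := @mx_norm_neq0 _ _ _ v.
  by apply: contra_neq v0; exact: mx_norm_eq0.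
rewrite [`|v|]vE ord1 real_normK ?num_real// /sqnorm (bigD1 j)//= lerDl.
by apply: sumr_ge0 => k _; exact: sqr_ge0.
Qed.

Lemma sqnorm_gt0 n (v : 'rV[R]_n) : v != 0 -> 0 < sqnorm v.
Proof.
move=> v0; apply: lt_le_trans (norm_sqr_le_sqnorm v).
by rewrite exprn_gt0// normr_gt0.
Qed.

Lemma sqnorm_lt n (v : 'rV[R]_n) (e : R) : 0 < e ->
  sqnorm v < e ^+ 2 -> `|v| < e.
Proof.
move=> e0 /(le_lt_trans (norm_sqr_le_sqnorm v)).
by rewrite ltr_pXn2r//; rewrite nnegrE ?normr_ge0 ?(ltW e0).
Qed.

Lemma sqnormN n (v : 'rV[R]_n) : sqnorm (- v) = sqnorm v.
Proof. by apply: eq_bigr => k _; rewrite mxE sqrrN. Qed.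

Lemma sqnorm0 n : sqnorm (0 : 'rV[R]_n) = 0.
Proof. by rewrite /sqnorm big1// => k _; rewrite mxE expr0n. Qed.

Lemma sqnorm_cvg (T : Type) (F : set_system T) {FF : Filter F} n
    (f : T -> 'rV[R]_n) (v : 'rV[R]_n) :
  f @ F --> v -> sqnorm (f x) @[x --> F] --> sqnorm v.
Proof.
move=> fv; apply: sum_cvg => k _; rewrite expr2; under eq_cvg do rewrite expr2.
by apply: cvgM; exact: coord_cvg.
Qed.

Lemma norm_sub_cvg n (z x : 'rV[R]_n) : `|y - z| @[y --> x] --> `|x - z|.
Proof.
apply: (@cvg_norm _ _ _ (nbhs x) _ (fun y => y - z)).
by apply: cvgB; [exact: cvg_id|exact: cvg_cst].
Qed.

Lemma continuous_sqnorm_sub (T : topologicalType) n (f : T -> 'rV[R]_n)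
    (a : 'rV[R]_n) (x : T) :
  {for x, continuous f} -> {for x, continuous (fun y => sqnorm (f y - a))}.
Proof.
move=> fx; apply: (@sqnorm_cvg _ (nbhs x) _ n (fun y => f y - a)).
by apply: cvgB => //; exact: cvg_cst.
Qed.

Lemma compact_ball n (z : 'rV[R]_n) (r : R) : compact [set x | `|x - z| <= r].
Proof.
apply: bounded_closed_compact.
  exists (r + `|z|); split; first exact: num_real.
  move=> M rM x /= xz; rewrite -(subrK z x) (le_trans (ler_normD _ _))//.
  by rewrite (le_trans _ (ltW rM))// lerD2r.
apply: (@preimage_closed _ _ (fun x : 'rV[R]_n => `|x - z|) [set t | t <= r]).
  by move=> x _; exact: norm_sub_cvg.
exact: closed_le.
Qed.

(** As [f] is continuous only at points of [K], the preimage alone need not be closed: a cluster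
    point is first placed in [K], and continuity is used there. *)
Lemma compact_setI_preimage n (K : set 'rV[R]_n) (f : 'rV[R]_n -> R) (C : set R) :
  compact K -> closed C -> (forall x, K x -> {for x, continuous f}) ->
  compact (K `&` f @^-1` C).
Proof.
move=> cK cC cf; apply: (subclosed_compact _ cK); last by move=> x [].
have clK : closed K by apply: compact_closed cK; exact: norm_hausdorff.
move=> x clx; have Kx : K x.
  by apply: clK => B /clx[y [[Ky _] By]]; exists y.
split => //=; apply: cC => B /(cf x Kx) /clx[y [[_ Cy] By]].
by exists (f y).
Qed.

Lemma ball_nbhs n (z : 'rV[R]_n) (P : set 'rV[R]_n) :
  (\forall x \near z, P x) -> exists2 r, 0 < r & forall x, `|x - z| <= r -> P x.
Proof.
move=> /nbhs_normP[r /= r0 Pr]; exists (r / 2); first by rewrite divr_gt0.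
by move=> x xz; apply: Pr => /=; rewrite distrC (le_lt_trans xz)//; lra.
Qed.

Lemma nbhs_norm_lt n (z x : 'rV[R]_n) r : `|x - z| < r ->
  \forall y \near x, `|y - z| < r.
Proof.
by move=> xr; exact: (norm_sub_cvg (open_nbhs_nbhs (conj (@open_lt R r) xr))).
Qed.

Lemma line_cvg n (x v : 'rV[R]_n) : t *: v + x @[t --> (0 : R)] --> x.
Proof.
rewrite -[X in _ --> X]add0r -(scale0r v); apply: cvgD; last exact: cvg_cst.
by apply: cvgZ; [exact: cvg_id|exact: cvg_cst].
Qed.

End EuclideanBalls.

(** * Local surjectivity of equidimensional immersions *)

Section LocalSurjectivity.
Context {R : realType}.

Lemma injective_diff_lower_bound n (f : 'rV[R]_n -> 'rV[R]_n) (x : 'rV[R]_n) :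
  differentiable f x -> injective ('d f x) ->
  exists2 c, 0 < c & \forall y \near x, c * `|y - x| <= `|f y - f x|.
Proof.
move=> df inj; pose J := jacobian f x.
have dE v : 'd f x v = v *m J by rewrite -deriveEjacobian// deriveE.
have Ju : J \in unitmx.
  rewrite -row_free_unit -kermx_eq0; apply/rowV0P => v /sub_kermxP vJ.
  by apply: inj; rewrite !dE vJ mul0mx.
have [k k0 Hk] : exists2 k, 0 < k & forall v : 'rV[R]_n, `|v *m invmx J| <= k * `|v|.
  have [|k k0 Hk] := @linear_lipschitz _ _ _ (mulmxr (invmx J) : 'rV[R]_n -> 'rV[R]_n).
    by move=> v; have := mulmx_cvg (@cvg_id _ (nbhs v)) (cvg_cst (invmx J)); exact.
  by exists k.
(* The differential expands lengths by at least [k^-1]; half of this is kept and the other half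
   absorbs the remainder. *)
have e0 : 0 < k^-1 / 2 by rewrite divr_gt0// invr_gt0.
exists (k^-1 / 2) => //.
have /eqaddoP/(_ _ e0) := diff_locally df.
move=> /nbhs_normP[r /= r0 Hr]; apply/nbhs_normP; exists r => //= y xy.
have /= := Hr (y - x); rewrite sub0r normrN distrC => /(_ xy).
rewrite !fctE/= subrK opprD addrA => Hy.
have := Hk ((y - x) *m J); rewrite mulmxK// -ler_pdivrMl// -dE => Hv.
have := ler_normB (f y - f x) (f y - f x - 'd f x (y - x)).
rewrite opprB addrCA subrr addr0.
have -> : k^-1 / 2 = k^-1 - k^-1 / 2 by field; rewrite gt_eqF.
rewrite (distrC y x) in Hv; rewrite mulrBl; lra.
Qed.

Lemma differentiable_entry (V : normedModType R) m n (f : V -> 'M[R]_(m, n)) x i j :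
  differentiable f x -> differentiable (fun y => f y i j) x.
Proof.
move=> df; apply: (@differentiable_comp _ _ _ _ f (fun M => M i j)) => //.
exact: differentiable_coord.
Qed.

Lemma derive_entry (V : normedModType R) m n (f : V -> 'M[R]_(m, n)) x v i j :
  differentiable f x -> 'D_v (fun y => f y i j) x = ('D_v f x) i j.
Proof. by move=> df; rewrite derive_mx ?mxE//; exact: diff_derivable. Qed.

Lemma differentiable_sqnorm_sub (V : normedModType R) n (f : V -> 'rV[R]_n) y x :
  differentiable f x -> differentiable (fun x => sqnorm (f x - y)) x.
Proof.
move=> df.
have -> : (fun x => sqnorm (f x - y)) = \sum_k (fun x => (f x - y) 0 k) ^+ 2.
  by apply/funext => z; rewrite fct_sumE.
apply: differentiable_sum => k; apply: differentiableX.
apply: (@differentiable_entry _ _ _ (fun z => f z - y)).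
by apply: differentiableB.
Qed.

Lemma derive_sqnorm_sub (V : normedModType R) n (f : V -> 'rV[R]_n) y x v :
  differentiable f x -> 'D_v (fun x => sqnorm (f x - y)) x =
    2 * \sum_k (f x - y) 0 k * ('D_v f x) 0 k.
Proof.
move=> df.
have -> : (fun x => sqnorm (f x - y)) = \sum_k (fun x => (f x - y) 0 k) ^+ 2.
  by apply/funext => z; rewrite fct_sumE.
have dfy : differentiable (fun z => f z - y) x by apply: differentiableB.
have dk k : derivable (fun z => (f z - y) 0 k) x v.
  exact/diff_derivable/(differentiable_entry _ _ dfy).
rewrite derive_sum; last by move=> k; apply: derivableX.
rewrite mulr_sumr; apply: eq_bigr => k _.
rewrite deriveX// derive_entry// deriveB ?derive_cst ?subr0//; last exact: diff_derivable.
by rewrite expr1 mulrA.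
Qed.

(* Over a small ball around [x0], the minimum of [|f - y|^2] is interior, so there
   [f - y] is orthogonal to the range of an invertible differential. *)
Lemma local_surjectivity n (U : set 'rV[R]_n) (f : 'rV[R]_n -> 'rV[R]_n)
    (x0 : 'rV[R]_n) : open U -> U x0 ->
  (forall x, U x -> differentiable f x) ->
  (forall x, U x -> injective ('d f x)) ->
  \forall y \near f x0, exists2 x, U x & f x = y.
Proof.
move=> oU Ux0 df inj.
have [c c0 fc] := injective_diff_lower_bound (df _ Ux0) (inj _ Ux0).
have [r r0 Hr] := ball_nbhs (filterI fc (open_nbhs_nbhs (conj oU Ux0))).
(* On the sphere of radius [r] the values of [f] are at distance at least [c * r] from [f x0]. A
   minimiser there would be, like [f x0], within less than [c * r / 2] of [y], which is
   impossible. *)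
have e0 : 0 < c * r / 2 by rewrite divr_gt0// mulr_gt0.
have sq0 : sqnorm (0 : 'rV[R]_n) < (c * r / 2) ^+ 2.
  by rewrite sqnorm0 exprn_gt0.
have sqc : sqnorm (y - f x0) @[y --> f x0] --> sqnorm (0 : 'rV[R]_n).
  by rewrite -(subrr (f x0)); apply: (@continuous_sqnorm_sub R _ n id).
have sqn := sqc _ (open_nbhs_nbhs (conj (@open_lt R _) sq0)).
near=> y.
have ylt : sqnorm (f x0 - y) < (c * r / 2) ^+ 2.
  by rewrite -sqnormN opprB; near: y; exact: sqn.
pose E x := sqnorm (f x - y).
have Ec x : U x -> {for x, continuous E}.
  by move=> Ux; apply/continuous_sqnorm_sub/differentiable_continuous/df.
have [|||x xr xmin] := @EVT_min_rV R n E [set x | `|x - x0| <= r].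
- by exists x0; rewrite /= subrr normr0 ltW.
- exact: compact_ball.
- apply: continuous_in_subspaceT => x; rewrite inE => /Hr[_ Ux]; exact: Ec.
have {}xr : `|x - x0| <= r by move: xr; rewrite inE.
have Ux : U x by have [] := Hr _ xr.
have Exx0 : E x <= E x0 by apply: xmin; rewrite inE/= subrr normr0 ltW.
have xlt : `|x - x0| < r.
  rewrite lt_neqAle xr andbT; apply/negP => /eqP xE.
  have [/= + _] := Hr _ xr; rewrite xE.
  have := sqnorm_lt e0 (le_lt_trans Exx0 ylt).
  have := sqnorm_lt e0 ylt.
  have := ler_normB (f x - y) (f x0 - y).
  rewrite opprB addrA subrK; lra.
exists x => //; apply/eqP; rewrite -subr_eq0; apply/negPn/negP => /sqnorm_gt0.
have dE v : 'd f x v = v *m jacobian f x.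
  by rewrite -deriveEjacobian ?deriveE//; exact: df.
have Ju : jacobian f x \in unitmx.
  rewrite -row_free_unit -kermx_eq0; apply/rowV0P => v /sub_kermxP vJ.
  by apply: (inj _ Ux); rewrite !dE vJ mul0mx.
(* In the direction [v] the differential of [f] is [f x - y], so the derivative of [E] is twice
   [sqnorm (f x - y)], and it vanishes at the interior minimum. *)
pose v := (f x - y) *m invmx (jacobian f x).
have dv : 'D_v f x = f x - y.
  by rewrite deriveEjacobian ?mulmxKV//; exact: df.
suff -> : sqnorm (f x - y) = 0 by rewrite ltxx.
pose h (t : R) := E (t *: v + x).
have near_line : \forall t \near (0 : R), U (t *: v + x) /\ `|t *: v + x - x0| < r.
  have lc := @line_cvg R n x v; apply: (@filterI _ (nbhs (0 : R))).
    exact: (lc _ (open_nbhs_nbhs (conj oU Ux))).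
  exact: (lc _ (nbhs_norm_lt xlt)).
have [e /= e0' He] := (@nbhs_normP R R^o _ _).1 near_line.
have dh t : U (t *: v + x) -> is_derive t (1 : R) h ('D_v E (t *: v + x)).
  move=> Utx; apply/is_derive_line/derivableP/diff_derivable.
  exact/differentiable_sqnorm_sub/df.
have hmin : is_derive (0 : R) (1 : R) h 0.
  apply: (@derive1_at_min _ h (- e) e); rewrite ?in_itv/=.
  - lra.
  - move=> t; rewrite in_itv/= => te; have [|Ut _] := He t.
      by rewrite /= sub0r normrN ltr_norml.
    by have [] := dh _ Ut.
  - lra.
  - move=> t; rewrite in_itv/= => te; have [|_ /ltW tr] := He t.
      by rewrite /= sub0r normrN ltr_norml.
    by rewrite /h scale0r add0r; apply: xmin; rewrite inE.
have [_ h0] := hmin; have [] := dh 0; first by rewrite scale0r add0r.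
rewrite h0 scale0r add0r derive_sqnorm_sub; last exact: df.
move=> _ /esym/eqP; rewrite mulf_eq0 pnatr_eq0/= => /eqP <-.
by apply: eq_bigr => k _; rewrite dv expr2.
Unshelve. all: by end_near. Qed.

End LocalSurjectivity.

(** * The strong maximum principle *)

Section StrongMaximumPrinciple.
Context {R : realType} {n : nat}.
Implicit Types (x y z v w : 'rV[R]_n) (A : R).

Lemma sqnorm_line t v w :
  sqnorm (t *: v + w) = sqnorm w + t * (2 * (v *m w^T) 0 0) + t ^+ 2 * sqnorm v.
Proof.
rewrite /sqnorm mxE !mulr_sumr -!big_split/=.
by apply: eq_bigr => k _; rewrite !mxE; ring.
Qed.

(* A quadratic function that vanishes at [z] and is positive outside the ball
   centred at [y] through [z]; off [z], it is nonpositive only in the interior of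
   that ball. *)
Definition sphere_defect y z x : R :=
  sqnorm (x - y) + sqnorm (x - z) - sqnorm (z - y).

Definition sphere_grad y z x : 'rV[R]_n := 2 *: (x - y + (x - z)).

Lemma sphere_defect_line y z x v t :
  sphere_defect y z (t *: v + x) = sphere_defect y z x +
    t * (v *m (sphere_grad y z x)^T) 0 0 + t ^+ 2 * (2 * sqnorm v).
Proof.
have -> : (v *m (sphere_grad y z x)^T) 0 0 =
    2 * (v *m (x - y)^T) 0 0 + 2 * (v *m (x - z)^T) 0 0.
  rewrite /sphere_grad linearZ/= linearD/= -scalemxAr mulmxDr [LHS]mxE.
  by rewrite [X in _ * X]mxE mulrDr.
by rewrite /sphere_defect -!(addrA (t *: v)) !sqnorm_line; ring.
Qed.

Lemma sphere_defect_center y z : sphere_defect y z z = 0.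
Proof. by rewrite /sphere_defect subrr sqnorm0 addr0 subrr. Qed.

Definition barrier A y z x : R :=
  A * sphere_defect y z x ^+ 2 - sphere_defect y z x.

(* The value at [x] on [barrier A y z] of the operator with coefficients [a] and
   [b]. *)
Definition barrier_operator A y z (a : 'M[R]_n) (b : 'rV[R]_n) x : R :=
  (2 * A * sphere_defect y z x - 1) *
    (4 * \tr a + (b *m (sphere_grad y z x)^T) 0 0) +
  2 * A * inner a (sphere_grad y z x) (sphere_grad y z x).

(** An elliptic operator without zeroth-order term is nonpositive at a maximum of the function it
    acts on; it annihilates [u], so only the barrier contributes. *)
Lemma barrier_operator_le0 (u : 'rV[R]_n -> R) (U : set 'rV[R]_n) A y z x e
    (a : 'M[R]_n) (b : 'rV[R]_n) :
  open U -> U x -> (forall y, U y -> differentiable u y) ->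
  (forall w y, U y -> differentiable ('D_w u) y) ->
  a^T = a -> (forall v, v != 0 -> 0 < inner a v v) ->
  \tr (a *m hessian u x) + \sum_c b 0 c * partial c u x = 0 ->
  0 < e ->
  (\forall w \near x, u w + e * barrier A y z w <= u x + e * barrier A y z x) ->
  barrier_operator A y z a b x <= 0.
Proof.
move=> oU Ux du ddu aS aP Lu e0 xmax.
set s := sphere_defect y z x; set g := sphere_grad y z x.
pose k := 2 * A * s - 1.
(* On the line through [x] along [v] the barrier is a polynomial, and the one-variable test yields
   both the gradient of [u] and a bound on its second derivative. *)
have test v : 'D_v u x = - e * k * (v *m g^T) 0 0 /\
    'D_v ('D_v u) x +
      e * (2 * A * (v *m g^T) 0 0 ^+ 2 + 4 * k * sqnorm v) <= 0.
  pose d := (v *m g^T) 0 0.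
  pose S : {poly R} := s%:P + d *: 'X + (2 * sqnorm v) *: 'X^2.
  pose P : {poly R} := e *: (A *: (S ^+ 2) - S).
  have PE t : e * barrier A y z (t *: v + x) = P.[t].
    rewrite /barrier sphere_defect_line /P /S -/s -/d.
    by rewrite !(hornerZ, hornerD, hornerN, hornerC, hornerX, hornerXn, horner_exp); ring.
  have line : \forall t \near (0 : R), is_derive (t : R) (1 : R)
      ((fun s => u (s *: v + x)) + (fun s => P.[s]))
      ('D_v u (t *: v + x) + P^`().[t]).
    near=> t; apply: is_deriveD; last exact: is_derive_poly.
    apply/is_derive_line/derivableP/diff_derivable/du.
    by near: t; exact: (@line_cvg R n x v _ (open_nbhs_nbhs (conj oU Ux))).
  have d2 : is_derive (0 : R) (1 : R)
      ((fun t => 'D_v u (t *: v + x)) + (fun t => P^`().[t]))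
      ('D_v ('D_v u) x + P^`()^`().[0]).
    have D1 : is_derive (0 : R) (1 : R) (fun t => 'D_v u (t *: v + x)) ('D_v ('D_v u) x).
      apply: (@is_derive_line _ _ _ ('D_v u) x v 0); rewrite scale0r add0r.
      exact/derivableP/diff_derivable/ddu.
    have D2 := is_derive_poly P^`() 0.
    exact: is_deriveD D1 D2.
  have lmax : \forall t \near (0 : R),
      ((fun s => u (s *: v + x)) + (fun s => P.[s])) t <=
      ((fun s => u (s *: v + x)) + (fun s => P.[s])) 0.
    near=> t; rewrite !fctE -!PE scale0r add0r.
    by near: t; exact: (@line_cvg R n x v _ xmax).
  have [] := derivative_test_max line d2 lmax.
  rewrite /= scale0r add0r /P /S.
  rewrite !(derivZ, derivD, derivB, derivN, derivC, derivX, derivXn, deriv_exp,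
    derivM, derivMn)/=.
  rewrite !(hornerZ, hornerD, hornerN, hornerM, hornerC, hornerX, hornerXn, horner_exp,
    hornerMn)/=.
  move=> E1 E2; split.
    apply/eqP; rewrite -subr_eq0; apply/eqP; rewrite -[RHS]E1 -/d /k; ring.
  apply: le_trans E2; rewrite le_eqVlt; apply/orP; left; apply/eqP.
  by rewrite -/d /k; ring.
rewrite /barrier_operator -/s -/g -/k; clearbody g.
(* [H] is the Hessian of [u + e * barrier] at [x]. After pairing with [a], the equation [Lu] and the
   gradient from [test] eliminate [u]. *)
pose H := hessian u x + e *: (2 * A *: (g^T *m g) + (4 * k) *: 1%:M).
have Hn v : inner H v v <= 0.
  have [_] := test v; rewrite (derive2_hessian _ oU Ux du ddu) /H innerDl innerZl.
  by rewrite innerDl !innerZl inner_rank1 inner1 -expr2.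
have := trace_posdef_le0 aS aP Hn.
rewrite /H mulmxDr mxtraceD -scalemxAr mxtraceZ mulmxDr mxtraceD -!scalemxAr.
rewrite !mxtraceZ mulmx1 mulmxA (mxtrace_mulC _ g) mulmxA.
have -> : \tr (g *m a *m g^T) = inner a g g by rewrite trace_mx11.
have -> : \tr (a *m hessian u x) = e * k * (b *m g^T) 0 0.
  apply/eqP; rewrite -subr_eq0 -[X in _ == X]Lu; apply/eqP; congr (_ + _).
  rewrite mxE mulr_sumr -sumrN; apply: eq_bigr => c _.
  by rewrite /partial (test _).1 -rowE !mxE; ring.
rewrite -mulrA -mulrDr pmulr_rle0//.
by move=> Hle; apply: le_trans Hle; rewrite le_eqVlt; apply/orP; left; apply/eqP; ring.
Unshelve. all: by end_near. Qed.

Variables (U : set 'rV[R]_n) (u : 'rV[R]_n -> R).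
Variables (a : 'rV[R]_n -> 'M[R]_n) (b : 'rV[R]_n -> 'rV[R]_n).
Hypotheses (oU : open U) (du : forall x, U x -> differentiable u x).
Hypothesis ddu : forall w x, U x -> differentiable ('D_w u) x.
Hypothesis ca : forall x, U x -> {for x, continuous a}.
Hypothesis cb : forall x, U x -> {for x, continuous b}.
Hypothesis aS : forall x, U x -> (a x)^T = a x.
Hypothesis aP : forall x, U x -> forall v, v != 0 -> 0 < inner (a x) v v.
Hypothesis Lu : forall x, U x ->
  \tr (a x *m hessian u x) + \sum_c b x 0 c * partial c u x = 0.

Lemma continuous_sphere_defect y z x :
  {for x, continuous (sphere_defect y z)}.
Proof.
apply: (@cvgB _ _ _ (nbhs x)); last exact: cvg_cst.
by apply: (@cvgD _ _ _ (nbhs x)); apply: (@continuous_sqnorm_sub R _ n id).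
Qed.

Lemma continuous_barrier A y z x : {for x, continuous (barrier A y z)}.
Proof.
apply: (@cvgB _ _ _ (nbhs x)); last exact: continuous_sphere_defect.
apply: (@cvgM _ _ (nbhs x)); first exact: cvg_cst.
have -> : (fun x => sphere_defect y z x ^+ 2) =
    (sphere_defect y z \* sphere_defect y z)%R by apply/funext => w; rewrite expr2.
by apply: (@cvgM _ _ (nbhs x)); exact: continuous_sphere_defect.
Qed.

(** This propagates the positivity of the operator on the barrier from one point to a neighbourhood,
    where [a] and [b] vary. *)
Lemma continuous_barrier_operator A y z x : U x ->
  {for x, continuous (fun w => barrier_operator A y z (a w) (b w) w)}.
Proof.
move=> Ux.
have cs := @continuous_sphere_defect y z x.
have cg : {for x, continuous (sphere_grad y z)}.
  apply: (@cvgZ _ _ _ (nbhs x)); first exact: cvg_cst.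
  by apply: (@cvgD _ _ _ (nbhs x)); apply: (@cvgB _ _ _ (nbhs x));
    [exact: cvg_id|exact: cvg_cst|exact: cvg_id|exact: cvg_cst].
have cgt : (sphere_grad y z w)^T @[w --> x] --> (sphere_grad y z x)^T.
  exact: (@trmx_cvg R _ (nbhs x)).
have ctr : \tr (a w) @[w --> x] --> \tr (a x).
  apply: (@sum_cvg R _ (nbhs x)) => i _.
  by apply: (@coord_cvg R _ (nbhs x)); exact: ca.
apply: (@cvgD _ _ _ (nbhs x)); apply: (@cvgM _ _ (nbhs x)).
- apply: (@cvgB _ _ _ (nbhs x)); last exact: cvg_cst.
  by apply: (@cvgM _ _ (nbhs x)) => //; exact: cvg_cst.
- apply: (@cvgD _ _ _ (nbhs x)).
    by apply: (@cvgM _ _ (nbhs x)) => //; exact: cvg_cst.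
  apply: (@coord_cvg R _ (nbhs x)).
  by apply: (@mulmx_cvg R _ (nbhs x)) => //; exact: cb.
- exact: cvg_cst.
- apply: (@coord_cvg R _ (nbhs x)).
  apply: (@mulmx_cvg R _ (nbhs x)) => //.
  by apply: (@mulmx_cvg R _ (nbhs x)) => //; exact: ca.
Qed.

(** Near [z] the operator is positive on the barrier, so [u + e * barrier] has no interior maximum
    on a small ball about [z]; yet for small [e] it is smaller on the boundary of that ball than at
    [z]. *)
Lemma interior_sphere_absurd y z : U z -> z != y ->
  (forall x, U x -> u x <= u z) ->
  (\forall x \near z, sqnorm (x - y) < sqnorm (z - y) -> u x < u z) -> False.
Proof.
move=> Uz zy uz uball.
have g0 : sphere_grad y z z != 0.
  by rewrite /sphere_grad subrr addr0 scaler_eq0 pnatr_eq0/= subr_eq0.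
set g := sphere_grad y z z in g0.
have gam0 := aP Uz g0.
pose l := 4 * \tr (a z) + (b z *m g^T) 0 0.
(* At [z] the defect is zero and the operator equals [2 * A * inner (a z) g g - l], which this [A]
   turns into [|l| + 1 - l]. *)
pose A := (`|l| + 1) / (2 * inner (a z) g g).
have A0 : 0 < A.
  by rewrite divr_gt0 ?mulr_gt0// ltr_wpDl.
have Lz : 0 < barrier_operator A y z (a z) (b z) z.
  rewrite /barrier_operator sphere_defect_center mulr0 sub0r mulN1r -/g -/l.
  have -> : 2 * A * inner (a z) g g = `|l| + 1.
    by rewrite /A; field; rewrite gt_eqF.
  by have := ler_norm l; lra.
have near_s : \forall x \near z, sphere_defect y z x < A^-1.
  have cs : sphere_defect y z x @[x --> z] --> (0 : R).
    by rewrite -(sphere_defect_center y z); exact: continuous_sphere_defect.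
  apply: (cs _ (open_nbhs_nbhs (conj (@open_lt R _) _))).
  by rewrite /= invr_gt0.
have near_L := @continuous_barrier_operator A y z z Uz _
  (open_nbhs_nbhs (conj (@open_gt R 0) Lz)).
have [r r0 Hr] := ball_nbhs (filterI (filterI near_s near_L)
   (filterI uball (open_nbhs_nbhs (conj oU Uz)))).
have {near_s near_L uball} Hr x : `|x - z| <= r ->
    [/\ sphere_defect y z x < A^-1, 0 < barrier_operator A y z (a x) (b x) x,
        sqnorm (x - y) < sqnorm (z - y) -> u x < u z & U x].
  by move=> /Hr[[? ?] [? ?]].
pose phi := barrier A y z.
have cphi x : {for x, continuous phi} by exact: continuous_barrier.
have cu x : U x -> {for x, continuous u}.
  by move=> /du; exact: differentiable_continuous.
(* With [s] the defect, the barrier [s * (A * s - 1)] is negative for [0 < s < A^-1], so here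
   [s <= 0]; since [x] differs from [z], it lies strictly inside the ball about [y]. *)
have uneg x : `|x - z| = r -> 0 <= phi x -> u x < u z.
  move=> xr; have [|sx _ ux _] := Hr x; first by rewrite xr.
  have s0 : 0 < sqnorm (x - z) by apply: sqnorm_gt0; rewrite -normr_gt0 xr.
  have := leP (sphere_defect y z x) 0; case=> [sle0 _|sgt0].
    by apply: ux; move: sle0; rewrite /sphere_defect; lra.
  have As : A * sphere_defect y z x < 1 by rewrite -ltr_pdivlMl// mulr1.
  rewrite /phi /barrier expr2 mulrA -[X in _ - X]mul1r -mulrBl leNgt.
  by rewrite pmulr_llt0// subr_lt0 As.
pose T := ([set x | `|x - z| <= r] `&` (fun x => `|x - z|) @^-1` [set r]) `&`
  phi @^-1` [set t | 0 <= t].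
have cT : compact T.
  apply: compact_setI_preimage; [|exact: closed_ge|by move=> x _; exact: cphi].
  apply: compact_setI_preimage; [exact: compact_ball|exact: closed_eq|].
  by move=> x _; exact: norm_sub_cvg.
have [e e0 He] : exists2 e, 0 < e &
    forall x, `|x - z| = r -> u x + e * phi x < u z.
  have [T0|/set0P T0] := eqVneq T set0.
    exists 1 => // x xr; rewrite mul1r; have [phi0|phi0] := leP 0 (phi x).
      suff : T x by rewrite T0.
      by split=> //; split; rewrite /= ?xr.
    by have [|_ _ _ /uz ux] := Hr x; [rewrite xr|lra].
  have [|c1 c1T umax] := @EVT_max_rV R n u T T0 cT.
    apply: continuous_in_subspaceT => x; rewrite inE => -[[/= xr _] _].
    by have [_ _ _ /cu] := Hr x xr.
  have [|c2 c2T pmax] := @EVT_max_rV R n phi T T0 cT.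
    by apply: continuous_in_subspaceT => x _; exact: cphi.
  have uc1 : u c1 < u z by move: c1T; rewrite inE => -[[_ /= c1r] c1p]; exact: uneg.
  have pc2 : 0 <= phi c2 by move: c2T; rewrite inE => -[].
  (* The [+ 1] covers the case where [phi] vanishes on [T]; the factor one half in [e] leaves a
     strict gap below [u z]. *)
  have p1 : 0 < phi c2 + 1 by rewrite ltr_wpDl.
  have e0 : 0 < (u z - u c1) / 2 / (phi c2 + 1) by rewrite !divr_gt0// subr_gt0.
  exists ((u z - u c1) / 2 / (phi c2 + 1)) => // x xr.
  set e := _ / (phi c2 + 1) in e0 *.
  have [phi0|phi0] := leP 0 (phi x); last first.
    have [|_ _ _ /uz ux] := Hr x; first by rewrite xr.
    have : e * phi x < 0 by rewrite pmulr_rlt0.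
    lra.
  have Tx : x \in T by rewrite inE; split=> //; split; rewrite /= ?xr.
  have h1 := umax x Tx.
  have h2 : e * phi x <= (u z - u c1) / 2.
    rewrite /e -(mulrA (_ / 2)) ler_piMr//; first by rewrite divr_ge0// subr_ge0 ltW.
    rewrite ler_pdivrMl// mulr1 (le_trans (pmax x Tx))//.
    by rewrite lerDl ler01.
  by lra.
have [|||x xr xmax] := @EVT_max_rV R n (fun x => u x + e * phi x)
    [set x | `|x - z| <= r].
- by exists z; rewrite /= subrr normr0 ltW.
- exact: compact_ball.
- apply: continuous_in_subspaceT => x; rewrite inE => /Hr[_ _ _ Ux].
  apply: (@cvgD _ _ _ (nbhs x)); first exact: cu.
  by apply: (@cvgM _ _ (nbhs x)); [exact: cvg_cst|exact: cphi].
have {}xr : `|x - z| <= r by move: xr; rewrite inE.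
have {}xmax w : `|w - z| <= r -> u w + e * phi w <= u x + e * phi x.
  by move=> wr; apply: xmax; rewrite inE.
have xlt : `|x - z| < r.
  rewrite lt_neqAle xr andbT; apply/negP => /eqP /He.
  have := xmax z; rewrite subrr normr0 ltW// => /(_ isT).
  rewrite {1}/phi /barrier sphere_defect_center expr0n/= mulr0 subr0 mulr0 addr0.
  by move=> h1 h2; have := le_lt_trans h1 h2; rewrite ltxx.
have [_ + _ Ux] := Hr x xr; apply/negP; rewrite -leNgt.
apply: (@barrier_operator_le0 u U A y z x e) => //; [exact: aS|exact: aP|exact: Lu|].
near=> w; apply: xmax; apply/ltW; near: w; exact: nbhs_norm_lt.
Unshelve. all: by end_near. Qed.

(* If [u] were not locally constant at [p], the largest ball in [{u < u p}] around
   a nearby point [y] with [u y < u p] would contradict [interior_sphere_absurd]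
   at a point [z] where it touches [{u = u p}]. *)
Lemma strong_maximum_principle p : U p -> (forall x, U x -> u x <= u p) ->
  \forall x \near p, u x = u p.
Proof.
move=> Up up.
have [r r0 Hr] := ball_nbhs (open_nbhs_nbhs (conj oU Up)).
(* A point of the level set nearest to [y] is within [r / 2] of [y], as [p] is, hence at distance
   less than [r] from [p], off the boundary where the level set is truncated. *)
have r20 : 0 < r / 2 by rewrite divr_gt0.
have near_p : \forall y \near p, sqnorm (y - p) < (r / 2) ^+ 2.
  have : sqnorm (y - p) @[y --> p] --> sqnorm (p - p).
    by apply: (@continuous_sqnorm_sub R _ n id).
  rewrite subrr sqnorm0 => cs.
  apply: (cs _ (open_nbhs_nbhs (conj (@open_lt R _) _))).
  by rewrite /= exprn_gt0.
near=> y; have yp : sqnorm (p - y) < (r / 2) ^+ 2.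
  by rewrite -sqnormN opprB; near: y.
have yr := sqnorm_lt r20 yp.
have Uy : U y by apply: Hr; rewrite distrC; lra.
apply/eqP; apply/negPn/negP => /eqP uy.
have cu x : U x -> {for x, continuous u}.
  by move=> /du; exact: differentiable_continuous.
pose S := [set x | `|x - p| <= r] `&` u @^-1` [set u p].
have Sp : S p by split => //=; rewrite subrr normr0 ltW.
have cS : compact S.
  apply: compact_setI_preimage; [exact: compact_ball|exact: closed_eq|].
  by move=> x /Hr; exact: cu.
have [||z zS zmin] := @EVT_min_rV R n (fun x => sqnorm (x - y)) S _ cS.
- by exists p.
- apply: continuous_in_subspaceT => x _.
  by apply: (@continuous_sqnorm_sub R _ n id).
have [/= zr uz] : S z by move: zS; rewrite inE.
have {}zmin x : S x -> sqnorm (z - y) <= sqnorm (x - y).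
  by move=> Sx; apply: zmin; rewrite inE.
have zy : `|z - y| < r / 2.
  by apply: sqnorm_lt => //; exact: le_lt_trans (zmin p Sp) yp.
have zp : `|z - p| < r.
  have := ler_normB (z - y) (p - y); rewrite opprB addrA subrK; lra.
apply: (@interior_sphere_absurd y z).
- exact: Hr.
- by apply: contra_notN uy => /eqP <-.
- by move=> x Ux; rewrite uz up.
- near=> x; rewrite ltNge => /negP xz; rewrite uz lt_neqAle up; last first.
    by apply: Hr; apply/ltW; near: x; exact: nbhs_norm_lt.
  rewrite andbT; apply/eqP => ux; apply: xz; apply: zmin; split => //=.
  by apply/ltW; near: x; exact: nbhs_norm_lt.
Unshelve. all: by end_near. Qed.

End StrongMaximumPrinciple.

(** * The elliptic equation satisfied by a coordinate of a minimal immersion *)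

Section SmoothFunctions.
Context {R : realType}.

Lemma near_eq_differentiable (V W : normedModType R) (f g : V -> W) (x : V) :
  (\forall y \near x, f y = g y) -> differentiable f x -> differentiable g x.
Proof.
move=> fg /diff_locallyP[cdf dfE].
have gE : g \o shift x = cst (g x) + 'd f x +o_ 0 id.
  apply/eqaddoP => e e0; move/eqaddoP : dfE => /(_ _ e0) dfE.
  have fgx := nbhs_singleton fg.
  have shx : (y + x) @[y --> (0 : V)] --> x.
    rewrite -[X in _ --> X]add0r.
    by apply: (@cvgD _ _ _ (nbhs (0 : V))); [exact: cvg_id|exact: cvg_cst].
  near=> y; have fgy : f (y + x) = g (y + x) by near: y; exact: (shx _ fg).
  by rewrite !fctE /= -fgy -fgx; near: y.
by apply/diff_locallyP; rewrite (diff_unique cdf gE).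
Unshelve. all: by end_near. Qed.

Lemma near_eq_continuous (S T : topologicalType) (f g : S -> T) (x : S) :
  (\forall y \near x, f y = g y) -> {for x, continuous f} -> {for x, continuous g}.
Proof.
move=> fg cf; rewrite /prop_for /continuous_at -(nbhs_singleton fg).
exact: cvg_trans (near_eq_cvg fg) cf.
Qed.

(** Formulas for derivatives often hold only on [U], so inductions on [k] need to replace a
    derivative by a function agreeing with it there. *)
Lemma eq_on_Ck k m (W : normedModType R) (U : set 'rV[R]_m) (f g : 'rV[R]_m -> W) :
  open U -> (forall x, U x -> f x = g x) -> Ck k U f -> Ck k U g.
Proof.
move=> oU; elim: k f g => [|k IH] f g fg /=.
  move=> cf x Ux; apply: near_eq_continuous (cf x Ux).
  by near=> y; apply: fg; near: y; exact: open_nbhs_nbhs.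
move=> [df ddf]; split=> [x Ux|v].
  apply: near_eq_differentiable (df x Ux).
  by near=> y; apply: fg; near: y; exact: open_nbhs_nbhs.
apply: IH (ddf v) => x Ux; apply: near_eq_derive.
by near=> y; apply: fg; near: y; exact: open_nbhs_nbhs.
Unshelve. all: by end_near. Qed.

Lemma Ck_entry k m p q (U : set 'rV[R]_m) (f : 'rV[R]_m -> 'M[R]_(p, q)) i j :
  open U -> Ck k U f -> Ck k U (fun x => f x i j).
Proof.
move=> oU; elim: k f => [|k IH] f /=.
  by move=> cf x /cf fx; apply: (@coord_cvg R _ (nbhs x)).
move=> [df ddf]; split=> [x /df|v]; first exact: differentiable_entry.
apply: (@eq_on_Ck k _ _ _ (fun x => ('D_v f x) i j)) => //; last exact: IH.
by move=> x /df dfx; rewrite derive_entry.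
Qed.

Lemma Ck_cst k m (W : normedModType R) (U : set 'rV[R]_m) (c : W) :
  Ck k U (fun _ => c).
Proof.
elim: k c => [|k IH] c /=; first by move=> x _; exact: cst_continuous.
split=> [x _|v]; first exact: differentiable_cst.
have -> : (fun x : 'rV[R]_m => 'D_v (fun=> c) x) = (fun=> 0).
  by apply/funext => x; exact: derive_cst.
exact: IH.
Qed.

Lemma Ck_lsubmx k m1 m2 (W : normedModType R) (U : set 'rV[R]_m1)
    (f : 'rV[R]_m1 -> W) :
  Ck k U f -> Ck k [set y : 'rV[R]_(m1 + m2) | U (lsubmx y)] (fun y => f (lsubmx y)).
Proof.
elim: k f => [|k IH] f /=.
  move=> cf y Uy; apply: (@continuous_comp _ _ _ lsubmx f); last exact: cf.
  exact/differentiable_continuous/differentiable_lsubmx.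
move=> [df ddf]; split=> [y Uy|v].
  apply: (@differentiable_comp _ _ _ _ lsubmx f); last exact: df.
  exact: differentiable_lsubmx.
have -> : (fun y => 'D_v (fun z => f (lsubmx z)) y) =
    (fun y => 'D_(lsubmx v) f (lsubmx y)).
  apply/funext => y; rewrite /derive.
  have -> : (fun h => h^-1 *: (((fun z => f (lsubmx z)) \o shift y) (h *: v) - f (lsubmx y))) =
      (fun h => h^-1 *: ((f \o shift (lsubmx y)) (h *: lsubmx v) - f (lsubmx y))) => //.
  by apply/funext => h /=; rewrite (linearP lsubmx).
exact: (IH ('D_(lsubmx v) f) (ddf _)).
Qed.

End SmoothFunctions.

Section MinimalCoordinate.
Context {R : realType} (n p : nat) (G : 'rV[R]_p -> 'M[R]_p).
Context (V : set 'rV[R]_p) (U : set 'rV[R]_n) (f : 'rV[R]_n -> 'rV[R]_p) (k : 'I_p).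
Hypotheses (oU : open U) (fV : forall x, U x -> V (f x)).
Hypothesis Gs : forall i j, Ck 1 V (fun y => G y i j).
Hypothesis GS : forall y, V y -> (G y)^T = G y.
Hypothesis GP : forall y, V y -> forall v, v != 0 -> 0 < inner (G y) v v.
Hypothesis fs : Ck 2 U f.
Hypothesis finj : forall x, U x -> injective ('d f x).

(** Entries are directional derivatives, whose continuity [Ck 2] provides; on [U] this is the
    Jacobian matrix. *)
Definition partials x : 'M[R]_(n, p) := \matrix_(a, l) partial a f x 0 l.
Definition gram_inv x : 'M[R]_n :=
  invmx (partials x *m G (f x) *m (partials x)^T).
(* The first-order coefficients, which come from the tangential part removed by
   [normal_part]. *)
Definition tangent_coef x : 'rV[R]_n :=
  - \sum_a \sum_b gram_inv x a b *:
      (cov_deriv G f a b x *m G (f x) *m (partials x)^T *m gram_inv x).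

Lemma jacobian_partials x : U x -> jacobian f x = partials x.
Proof.
move=> Ux; apply/matrixP => a l; have df := fs.1 _ Ux.
by rewrite [RHS]mxE /partial deriveEjacobian// -rowE [RHS]mxE.
Qed.

Lemma gram_posdef x : U x -> forall v, v != 0 ->
  0 < inner (partials x *m G (f x) *m (partials x)^T) v v.
Proof.
move=> Ux; apply: posdef_congr => [|v]; first exact/GP/fV.
have df := fs.1 _ Ux; rewrite -jacobian_partials// -deriveEjacobian// deriveE//.
by move=> vf; apply: (finj Ux); rewrite vf linear0.
Qed.

Lemma gram_sym x : U x ->
  (partials x *m G (f x) *m (partials x)^T)^T =
  partials x *m G (f x) *m (partials x)^T.
Proof. by move=> Ux; rewrite !trmx_mul trmxK mulmxA GS//; exact: fV. Qed.

Lemma gram_inv_sym x : U x -> (gram_inv x)^T = gram_inv x.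
Proof. by move=> Ux; rewrite trmx_inv gram_sym. Qed.

Lemma gram_inv_posdef x : U x -> forall v, v != 0 -> 0 < inner (gram_inv x) v v.
Proof. by move=> Ux; apply: posdef_invmx; [exact: gram_sym|exact: gram_posdef]. Qed.

(** In the [k]-th entry of the mean curvature, the vanishing symbols leave plain second derivatives
    of the coordinate; the tangential part is a combination of the rows of [partials x], hence of
    first order in it. *)
Lemma minimal_coordinate_eq x : U x ->
  (forall i j, christoffel G i j k (f x) = 0) -> mean_curvature G f x = 0 ->
  \tr (gram_inv x *m hessian (fun y => f y 0 k) x) +
    \sum_c tangent_coef x 0 c * partial c (fun y => f y 0 k) x = 0.
Proof.
move=> Ux Gk mc; transitivity (mean_curvature G f x 0 k); last by rewrite mc mxE.
have -> : \sum_c tangent_coef x 0 c * partial c (fun y => f y 0 k) x =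
    - \sum_a \sum_b gram_inv x a b * (cov_deriv G f a b x *m G (f x) *m
      (partials x)^T *m gram_inv x *m partials x) 0 k.
  transitivity ((tangent_coef x *m partials x) 0 k).
    rewrite mxE; apply: eq_bigr => c _; congr (_ * _).
    by rewrite mxE /partial derive_entry//; exact: fs.1.
  rewrite /tangent_coef mulNmx mxE mulmx_suml summxE; congr (- _).
  apply: eq_bigr => a _; rewrite mulmx_suml summxE; apply: eq_bigr => b _.
  by rewrite -scalemxAl mxE.
have -> : \tr (gram_inv x *m hessian (fun y => f y 0 k) x) =
    \sum_a \sum_b gram_inv x a b * partial a (partial b f) x 0 k.
  rewrite /mxtrace; under eq_bigr => i _ do rewrite mxE.
  rewrite exchange_big/=; apply: eq_bigr => i _; apply: eq_bigr => j _.
  rewrite -{1}gram_inv_sym// !mxE; congr (_ * _).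
  rewrite /partial -derive_entry; last exact: (fs.2 _).1.
  apply: near_eq_derive; near=> y; rewrite derive_entry//; apply: fs.1; near: y.
  exact: open_nbhs_nbhs.
rewrite -sumrN -big_split/= /mean_curvature summxE.
apply: eq_bigr => a _; rewrite summxE -sumrN -big_split/=.
apply: eq_bigr => b _; rewrite [RHS]mxE -mulrBr; congr (_ * _).
rewrite /second_form /normal_part /first_form !jacobian_partials// -/(gram_inv x).
rewrite [RHS]mxE [X in _ = _ + X]mxE; congr (_ - _);
  last by rewrite /first_form !jacobian_partials.
rewrite [RHS]mxE [X in _ = _ + X]mxE [X in _ + X]big1 ?addr0// => i _.
by rewrite big1// => j _; rewrite Gk mulr0.
Unshelve. all: by end_near. Qed.

Lemma continuous_partials x : U x -> {for x, continuous partials}.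
Proof.
move=> Ux; apply: (@mx_cvg R _ (nbhs x)) => a l; rewrite !mxE.
under eq_cvg do rewrite mxE.
apply: (@coord_cvg R _ (nbhs x)).
exact/differentiable_continuous/(fs.2 _).1.
Qed.

Lemma continuous_comp_f (T : topologicalType) (h : 'rV[R]_p -> T) x : U x ->
  {for f x, continuous h} -> {for x, continuous (fun y => h (f y))}.
Proof.
move=> Ux ch; apply: (@continuous_comp _ _ _ f h) => //.
exact/differentiable_continuous/fs.1.
Qed.

Lemma continuous_metric y : V y -> {for y, continuous G}.
Proof.
move=> Vy; apply: (@mx_cvg R _ (nbhs y)) => i j.
exact/differentiable_continuous/(Gs i j).1.
Qed.

Lemma continuous_gram_inv x : U x -> {for x, continuous gram_inv}.
Proof.
move=> Ux; apply: (@invmx_cvg R _ (nbhs x)).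
  exact/posdef_unitmx/gram_posdef.
have cP := continuous_partials Ux.
apply: (@mulmx_cvg R _ (nbhs x)); last exact: (@trmx_cvg R _ (nbhs x)).
apply: (@mulmx_cvg R _ (nbhs x)) => //.
exact/continuous_comp_f/continuous_metric/fV.
Qed.

Lemma continuous_christoffel i j l y : V y ->
  {for y, continuous (christoffel G i j l)}.
Proof.
move=> Vy; apply: (@cvgM _ _ (nbhs y)); first exact: cvg_cst.
apply: (@sum_cvg R _ (nbhs y)) => q _; apply: (@cvgM _ _ (nbhs y)).
  apply: (@coord_cvg R _ (nbhs y)); apply: (@invmx_cvg R _ (nbhs y)).
    exact/posdef_unitmx/GP.
  exact: continuous_metric.
apply: (@cvgB _ _ _ (nbhs y)); last exact: (Gs i j).2.
by apply: (@cvgD _ _ _ (nbhs y)); exact: (Gs _ _).2.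
Qed.

Lemma continuous_cov_deriv a b x : U x ->
  {for x, continuous (cov_deriv G f a b)}.
Proof.
move=> Ux; apply: (@cvgD _ _ _ (nbhs x)); first exact: ((fs.2 _).2 _).
apply: (@mx_cvg R _ (nbhs x)) => z l; rewrite !mxE.
under eq_cvg do rewrite mxE.
apply: (@sum_cvg R _ (nbhs x)) => i _; apply: (@sum_cvg R _ (nbhs x)) => j _.
apply: (@cvgM _ _ (nbhs x)).
  by apply: (@cvgM _ _ (nbhs x)); apply: (@coord_cvg R _ (nbhs x));
    exact/differentiable_continuous/(fs.2 _).1.
exact/continuous_comp_f/continuous_christoffel/fV.
Qed.

Lemma continuous_tangent_coef x : U x -> {for x, continuous tangent_coef}.
Proof.
move=> Ux; have cI := continuous_gram_inv Ux.
apply: (@cvgN _ _ _ (nbhs x)).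
apply: (@sum_cvg R _ (nbhs x)) => a _; apply: (@sum_cvg R _ (nbhs x)) => b _.
apply: (@cvgZ _ _ _ (nbhs x)); first exact: (@coord_cvg R _ (nbhs x)).
apply: (@mulmx_cvg R _ (nbhs x)) => //.
apply: (@mulmx_cvg R _ (nbhs x)); last first.
  by apply: (@trmx_cvg R _ (nbhs x)); exact: continuous_partials.
apply: (@mulmx_cvg R _ (nbhs x)); first exact: continuous_cov_deriv.
exact/continuous_comp_f/continuous_metric/fV.
Qed.

Lemma minimal_coordinate_locally_constant x0 :
  (forall x i j, U x -> christoffel G i j k (f x) = 0) ->
  (forall x, U x -> mean_curvature G f x = 0) ->
  U x0 -> (forall x, U x -> f x 0 k <= f x0 0 k) ->
  \forall x \near x0, f x 0 k = f x0 0 k.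
Proof.
move=> Gk mc Ux0 xmax.
have us : Ck 2 U (fun y => f y 0 k) by apply: Ck_entry.
apply: (@strong_maximum_principle _ _ U (fun y => f y 0 k) gram_inv tangent_coef) => //.
- exact: us.1.
- by move=> w; exact: (us.2 w).1.
- exact: continuous_gram_inv.
- exact: continuous_tangent_coef.
- exact: gram_inv_sym.
- exact: gram_inv_posdef.
- by move=> x Ux; apply: minimal_coordinate_eq => // *; [exact: Gk|exact: mc].
Qed.

End MinimalCoordinate.

(** * Closed minimal hypersurfaces of a cylinder *)

Section Cylinder.
Context {R : realType} (n : nat) (N : topologicalType) (AN : atlas R n N).
Variables (g : metric_data AN) (hN : is_manifold AN) (hg : is_riemannian g).
Local Notation G := (cyl_metric g).
Local Notation top := (rshift n (0 : 'I_1)).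

Let cyl_dom (j : idx AN) : set 'rV[R]_(n + 1) := [set y | cod j (lsubmx y)].

Lemma cyl_metric_topr j y a : G j y a top = (a == top)%:R.
Proof.
rewrite /cyl_metric; case: (split_ordP a) => l ->.
  by rewrite block_mxEur mxE eq_lrshift.
by rewrite block_mxEdr !mxE eq_rshift.
Qed.

Lemma cyl_metric_topl j y a : G j y top a = (top == a)%:R.
Proof.
rewrite /cyl_metric; case: (split_ordP a) => l ->.
  by rewrite block_mxEdl mxE eq_rlshift.
by rewrite block_mxEdr !mxE eq_rshift.
Qed.

Lemma invmx_cyl_metric_top j y l : l != top -> invmx (G j y) top l = 0.
Proof.
move=> ltop; have rG : row top (G j y) = delta_mx 0 top.
  apply/rowP => a.
  by rewrite [LHS]mxE [RHS]mxE cyl_metric_topl eqxx eq_sym.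
have rI : row top (invmx (G j y)) = delta_mx 0 top.
  (* On a singular matrix [invmx] is the identity, so [rG] already gives the row. *)
  have [Gu|Gn] := boolP (G j y \in unitmx); last by rewrite invmx_out.
  by rewrite rowE -{1}rG rowE -mulmxA mulmxV// mulmx1.
have : row top (invmx (G j y)) 0 l = 0.
  by rewrite rI mxE (negPf ltop) andbF.
by rewrite mxE.
Qed.

(** Only [l = top] survives in the sum. Its three derivatives vanish: the [top] column of the metric
    is constant, and no entry depends on the height. *)
Lemma christoffel_cyl_metric_top j a b y : christoffel (G j) a b top y = 0.
Proof.
rewrite /christoffel big1 ?mulr0// => l _.
have [->|ltop] := eqVneq l top; last by rewrite invmx_cyl_metric_top ?mul0r.
have dtop c d : partial c (fun z => G j z d top) y = 0.
  have -> : (fun z => G j z d top) = cst (d == top)%:R.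
    by apply/funext => z; rewrite cyl_metric_topr.
  exact: derive_cst.
have dabs : partial top (fun z => G j z a b) y = 0.
  rewrite /partial /derive.
  have -> : (fun h => h^-1 *: (((fun z => G j z a b) \o shift y)
      (h *: delta_mx 0 top) - G j y a b)) = cst (0 : R).
    apply/funext => h /=; rewrite /cyl_metric.
    have -> : lsubmx (h *: delta_mx 0 top + y) = lsubmx y.
      by apply/rowP => c; rewrite !mxE eq_lrshift andbF mulr0 add0r.
    by rewrite subrr scaler0.
  exact: lim_cst.
by rewrite !dtop dabs addr0 subrr mulr0.
Qed.

Lemma cyl_metric_Ck k j a b : Ck k (cyl_dom j) (fun y => G j y a b).
Proof.
have [gs _ _ _] := hg; have [_ [/(_ j)[_ oc _ _] _ _]] := hN.
have [->|atop] := eqVneq a top.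
  have -> : (fun y => G j y top b) = fun=> (top == b)%:R.
    by apply/funext => y; rewrite cyl_metric_topl.
  exact: Ck_cst.
have [->|btop] := eqVneq b top.
  have -> : (fun y => G j y a top) = fun=> (a == top)%:R.
    by apply/funext => y; rewrite cyl_metric_topr.
  exact: Ck_cst.
case: (split_ordP a) atop => l -> => [_|]; last by rewrite ord1 eqxx.
case: (split_ordP b) btop => l' -> => [_|]; last by rewrite ord1 eqxx.
have -> : (fun y => G j y (lshift 1 l) (lshift 1 l')) = (fun y => g j (lsubmx y) l l').
  by apply/funext => y; rewrite /cyl_metric block_mxEul.
apply: (@Ck_lsubmx R k n 1 R (cod j) (fun z => g j z l l')).
by apply: Ck_entry => //; exact: gs.
Qed.

Lemma cyl_metric_sym j y : cyl_dom j y -> (G j y)^T = G j y.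
Proof.
move=> Vy; have [_ gS _ _] := hg.
by rewrite /cyl_metric tr_block_mx !trmx0 trmx1 gS.
Qed.

Lemma cyl_metric_posdef j y : cyl_dom j y ->
  forall v, v != 0 -> 0 < inner (G j y) v v.
Proof.
move=> Vy v v0; have [_ _ gP _] := hg.
have vE : inner (G j y) v v =
    inner (g j (lsubmx y)) (lsubmx v) (lsubmx v) + sqnorm (rsubmx v).
  rewrite -[sqnorm _]inner1 /inner -{1 2}(hsubmxK v) mul_row_block !mulmx0 addr0 add0r.
  by rewrite tr_row_mx mul_row_col mxE.
rewrite {}vE; have [l0|l0] := eqVneq (lsubmx v) 0; last first.
  by apply: ltr_wpDr; [exact: sqnorm_ge0|exact: gP].
rewrite l0 /inner mul0mx mul0mx mxE add0r; apply: sqnorm_gt0.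
by apply: contra_neq v0 => r0; rewrite -(hsubmxK v) l0 r0 row_mx0.
Qed.

(** * Height and projection of a closed minimal hypersurface *)

Section ClosedMinimalHypersurface.
Variables (M : topologicalType) (A : atlas R n M) (F : M -> (N * R)%type).
Hypotheses (hM : is_manifold A) (hF : immersion A (cyl_atlas AN) F).

Let dom2 i (j : idx AN) : set 'rV[R]_n := @local_dom _ _ _ _ _ A (cyl_atlas AN) F i j.
Let expr i (j : idx AN) : 'rV[R]_n -> 'rV[R]_(n + 1) :=
  @local_expr _ _ _ _ _ A (cyl_atlas AN) F i j.

Lemma continuous_height : continuous (fun m => (F m).2).
Proof.
move=> m; apply: (@continuous_comp _ _ _ F snd); first exact: hF.1.1.
exact: cvg_snd.
Qed.

Lemma continuous_proj : continuous (fun m => (F m).1).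
Proof.
move=> m; apply: (@continuous_comp _ _ _ F fst); first exact: hF.1.1.
exact: cvg_fst.
Qed.

Lemma open_local_dom i j : open (dom2 i j).
Proof.
have [_ [/(_ i)[_ oc _ pc] _ _]] := hM; have [_ [/(_ j)[od _ _ _] _ _]] := hN.
rewrite openE => x [cx dx]; apply: filterI; first exact: open_nbhs_nbhs.
have [_ _ cpar] := pc _ cx.
have c : {for x, continuous (fun y => (F (par i y)).1)}.
  by apply: (@continuous_comp _ _ _ (par i) (fun m => (F m).1)) => //; exact: continuous_proj.
by apply: c; exact: open_nbhs_nbhs.
Qed.

Lemma local_expr_top i j x : expr i j x 0 top = (F (par i x)).2.
Proof. by rewrite /expr /local_expr row_mxEr mxE. Qed.

Lemma lsubmx_local_expr i j x : lsubmx (expr i j x) = crd j (F (par i x)).1.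
Proof. by rewrite /expr /local_expr row_mxKl. Qed.

Lemma local_expr_cyl_dom i j x : dom2 i j x -> cyl_dom j (expr i j x).
Proof.
have [_ [/(_ j)[_ _ dc _] _ _]] := hN.
by move=> [_ /dc[cj _ _]]; rewrite /cyl_dom /= lsubmx_local_expr.
Qed.

Lemma local_exprs m : exists i (j : idx AN),
  [/\ dom i m, dom2 i j (crd i m), par i (crd i m) = m & {for m, continuous (crd i)}].
Proof.
have [_ [ch cov _]] := hM; have [_ [_ covN _]] := hN.
have [i im] := cov m; have [j jm] := covN (F m).1; exists i, j.
by have [_ _ /(_ m im)[cm pm crdm] _] := ch i; split=> //; split; rewrite ?pm.
Qed.

(** The maximum principle gives constancy only near a point of maximal height, in one pair of
    charts. So the set [C] of such points is open; it is closed by continuity, and connectedness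
    concludes. *)
Lemma minimal_height_constant : compact [set: M] -> minimal A (cyl_metric g) F ->
  exists t, forall m, (F m).2 = t.
Proof.
move=> cM Fmin; have [[_ _ Mco M0] _] := hM.
have [|m0 _ hmax] := @compact_EVT_max _ R (fun m => (F m).2) setT M0 cM.
  by apply: continuous_subspaceT; exact: continuous_height.
have {}hmax m : (F m).2 <= (F m0).2 by apply: hmax; rewrite inE.
exists (F m0).2; pose C := [set m | (F m).2 = (F m0).2].
suff CT : C = setT by move=> m; have : C m by rewrite CT.
apply: Mco; first by exists m0.
  exists C; last by rewrite setTI.
  rewrite openE => m Cm; have [i [j [im Um pm crdm]]] := local_exprs m.
  have loc : \forall x \near crd i m, expr i j x 0 top = expr i j (crd i m) 0 top.
    apply: (@minimal_coordinate_locally_constant R n (n + 1) (cyl_metric g j)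
      (cyl_dom j) (dom2 i j) (expr i j) top) => //.
    - exact: open_local_dom.
    - exact: local_expr_cyl_dom.
    - exact: cyl_metric_Ck.
    - exact: cyl_metric_sym.
    - exact: cyl_metric_posdef.
    - exact: hF.1.2.
    - exact: hF.2.
    - by move=> x a b _; exact: christoffel_cyl_metric_top.
    - exact: Fmin.
    - by move=> x _; rewrite !local_expr_top pm Cm.
  have [_ [/(_ i)[od _ dc _] _ _]] := hM.
  near=> m'; have im' : dom i m' by near: m'; exact: open_nbhs_nbhs.
  have [_ pm' _] := dc _ im'; rewrite /C /= -pm' -(local_expr_top i j).
  transitivity (expr i j (crd i m) 0 top); last by rewrite local_expr_top pm.
  by near: m'; exact: (crdm _ loc).
exists C; last by rewrite setTI.
apply: (@preimage_closed _ _ (fun m => (F m).2) [set t | t = (F m0).2]).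
  by move=> m _; exact: continuous_height.
exact: closed_eq.
Unshelve. all: by end_near. Qed.

(** Constant height kills the last entry of the differential, so injectivity passes to the first [n]
    entries and [local_surjectivity] applies in charts. *)
Lemma horizontal_immersion_open t : (forall m, (F m).2 = t) ->
  open (range (fst \o F)).
Proof.
move=> Ft; rewrite openE => _ [m _ <-].
have [i [j [im Um pm crdm]]] := local_exprs m.
have df x : dom2 i j x -> differentiable (expr i j) x.
  exact: (hF.1.2 i j 1%N).1.
pose phi x := lsubmx (expr i j x).
have dphi x : dom2 i j x -> differentiable phi x.
  move=> Ux; apply: (@differentiable_comp _ _ _ _ (expr i j) lsubmx).
    exact: df.
  exact: differentiable_lsubmx.
have phiE x v l : dom2 i j x -> 'd phi x v 0 l = 'd (expr i j) x v 0 (lshift 1 l).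
  move=> Ux; have dfx := df _ Ux; have dphix := dphi _ Ux.
  rewrite -(deriveE _ dphix) -(deriveE _ dfx).
  rewrite -(derive_entry _ _ _ (dphi _ Ux)) -(derive_entry _ _ _ (df _ Ux)).
  by congr ('D_v _ x); apply/funext => y; rewrite mxE.
have topE x v : dom2 i j x -> 'd (expr i j) x v 0 top = 0.
  move=> Ux; have dfx := df _ Ux; rewrite -deriveE// -(derive_entry _ _ _ (df _ Ux)).
  have -> : (fun y => expr i j y 0 top) = cst t.
    by apply/funext => y; rewrite local_expr_top Ft.
  exact: derive_cst.
have phi_inj x : dom2 i j x -> injective ('d phi x).
  move=> Ux v w vw; apply: (hF.2 i j x Ux); apply/rowP => l.
  case: (split_ordP l) => l' ->; first by rewrite -!phiE// vw.
  by rewrite ord1 !topE.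
have loc := @local_surjectivity R n (dom2 i j) phi (crd i m)
  (@open_local_dom i j) Um dphi phi_inj.
have phim : phi (crd i m) = crd j (F m).1 by rewrite /phi lsubmx_local_expr pm.
rewrite phim in loc.
have [_ [/(_ j)[od _ dc _] _ _]] := hN.
have jm : dom j (F m).1 by case: Um => _ /=; rewrite pm.
have [_ _ cj] := dc _ jm.
near=> q; have jq : dom j q by near: q; exact: open_nbhs_nbhs.
have [x Ux xq] : exists2 x, dom2 i j x & phi x = crd j q.
  by near: q; exact: (cj _ loc).
exists (par i x) => //=.
have [_ jx] := Ux; have [_ <- _] := dc _ jq; have [_ <- _] := dc _ jx.
by rewrite -xq /phi lsubmx_local_expr.
Unshelve. all: by end_near. Qed.

Lemma closed_minimal_proj_surjective : compact [set: M] ->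
  minimal A (cyl_metric g) F -> range (fst \o F) = [set: N].
Proof.
move=> cM Fmin; have [t Ft] := minimal_height_constant cM Fmin.
have [[hausN _ Nco _] _] := hN; have [[_ _ _ [m _]] _] := hM.
apply: Nco; first by exists (F m).1, m.
  by exists (range (fst \o F)); [exact: horizontal_immersion_open Ft|rewrite setTI].
exists (range (fst \o F)); last by rewrite setTI.
apply: compact_closed => //; apply: continuous_compact => //.
by apply: continuous_subspaceT; exact: continuous_proj.
Qed.

End ClosedMinimalHypersurface.
End Cylinder.

Theorem theorem1p4 (R : realType) (n : nat)
  (N : topologicalType) (AN : atlas R n N) (g : metric_data AN)
  (M1 M2 : topologicalType) (A1 : atlas R n M1) (A2 : atlas R n M2)
  (F1 : M1 -> (N * R)%type) (F2 : M2 -> (N * R)%type)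
  (hN : is_manifold AN) (hg : is_riemannian g)
  (hcomplete : complete_metric g) (hsec : positive_sectional_curvature g)
  (hM1 : is_manifold A1) (hM2 : is_manifold A2)
  (hF1 : immersion A1 (cyl_atlas AN) F1)
  (hF2 : immersion A2 (cyl_atlas AN) F2)
  (hmin1 : minimal A1 (cyl_metric g) F1)
  (hmin2 : minimal A2 (cyl_metric g) F2)
  (hclosed1 : compact [set: M1])
  (hproper2 : proper_map F2) :
  (exists s : R, ((vtrans s @` range F1) `&` range F2) !=set0) /\
  ((fst @` range F1) `&` (fst @` range F2)) !=set0.

Proof.
have proj1 := closed_minimal_proj_surjective hN hg hM1 hF1 hclosed1 hmin1.
have [[_ _ _ [m2 _]] _] := hM2.
have [m1 _ m12] : range (fst \o F1) (F2 m2).1 by rewrite proj1.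
split.
  (* The two points have the same projection, so translating by the difference of their heights
     makes them coincide. *)
  exists ((F2 m2).2 - (F1 m1).2), (F2 m2); split; last by exists m2.
  exists (F1 m1); first by exists m1.
  by rewrite /vtrans (_ : (F1 m1).1 = (F2 m2).1)// addrC subrK; case: (F2 m2).
exists (F2 m2).1; split; last by exists (F2 m2) => //; exists m2.
by exists (F1 m1) => //; exists m1.
Qed.
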